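(* Fix $q>0$ and let $\mathcal{K}_N$ be the complete graph on the vertex set $[N]=\{1,\dots,N\}$, $N\ge 1$, with constant edge weight $w>0$. Let $U^{(N)}_q(x,y)$ be the pairwise LEP-interaction potential on $\mathcal{K}_N$ with parameter $q$. Then, for all $x\neq y\in[N]$, $$U^{(N)}_q(x,y)=U^{(N)}_q=\sum_{h=1}^{N-1}\frac{q}{q+Nw}\left(\frac{Nw}{q+Nw}\right)^{h-1}\prod_{k=2}^{h}\left(1-\frac{k}{N}\right).$$ Furthermore, if $q=q_N=z\, w\sqrt{N}$ for fixed $z,w>0$, then $$\lim_{N\to\infty}U^{(N)}_{q}=\sqrt{2\pi}\,z\,e^{\frac{z^2}{2}}\,\mathbb{P}(Z>z),$$ where $Z$ is a standard Gaussian random variable.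
   Context: Let $G=(V,E,w)$ be a finite simple undirected connected weighted graph with edge weights $w:E\to[0,\infty)$. A spanning rooted forest $F$ of $G$ is a collection of vertex-disjoint rooted trees in $G$ whose vertex sets cover $V$; $|F|$ is its number of trees, $w(F)=\prod_{e\in F}w(e)$ is its weight (empty product equal to $1$), and $\Pi(F)$ is the partition of $V$ whose blocks are the vertex sets of the trees of $F$. For $q>0$, the loop-erased partition $\Pi_q$ is the random partition of $V$ with law $$\mathbb{P}(\Pi_q=\Pi)=\frac{1}{Z(q)}\sum_{F:\,\Pi(F)=\Pi}q^{|F|}w(F),\qquad Z(q)=\sum_{F}q^{|F|}w(F),$$ where sums are over spanning rooted forests of $G$ (the same tree with two different choices of root counts as two different rooted trees). For $x\in V$, $B_q(x)$ denotes the block of $\Pi_q$ containing $x$. The pairwise LEP-interaction potential is $U_q(x,y):=\mathbb{P}(B_q(x)\neq B_q(y))$ for distinct $x,y\in V$. The superscript $(N)$ indicates dependence on $N$. Empty products equal $1$. *)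

(* Defs.v *)
From HB Require Import structures.
From mathcomp Require Import all_boot all_order all_algebra.
From mathcomp Require Import boolp reals.

Set Implicit Arguments.
Unset Strict Implicit.
Unset Printing Implicit Defensive.

Import Order.TTheory GRing.Theory Num.Theory.
Local Open Scope ring_scope.

(** An edge is a two-element set of vertices. *)
Definition adj (V : finType) (A : {set {set V}}) : rel V :=
  [rel x y | [set x; y] \in A].

Record wgraph (R : realType) (V : finType) := WGraph {
  edges : {set {set V}};
  weight : {set V} -> R;
  edges_simple : forall e, e \in edges -> #|e| = 2%N;
  weight_ge0 : forall e, e \in edges -> 0 <= weight e;
  wgraph_connected : forall x y, connect (adj edges) x y }.

(** [x; y] is a [ucycle] as soon as xy is an edge, hence the size bound. *)
Definition acyclic (V : finType) (A : {set {set V}}) : bool :=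
  `[< forall c : seq V, ucycle (adj A) c -> (size c <= 2)%N >].

(** A triple (vertex set, edge set, root), before any condition is imposed. *)
Definition rtree (V : finType) : Type := ({set V} * {set {set V}} * V)%type.

Definition tverts (V : finType) (T : rtree V) : {set V} := T.1.1.
Definition tedges (V : finType) (T : rtree V) : {set {set V}} := T.1.2.
Definition troot (V : finType) (T : rtree V) : V := T.2.

Section LoopErasedPartition.
Variables (R : realType) (V : finType) (G : wgraph R V).

Definition rooted_tree (T : rtree V) : bool :=
  [&& troot T \in tverts T,
      tedges T \subset [set e in edges G | e \subset tverts T],
      [forall x in tverts T, forall y in tverts T, connect (adj (tedges T)) x y]
    & acyclic (tedges T)].

Definition spanning_rooted_forest (F : {set rtree V}) : bool :=
  [&& [forall T in F, rooted_tree T],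
      [forall T1 in F, forall T2 in F,
         (T1 != T2) ==> [disjoint tverts T1 & tverts T2]]
    & \bigcup_(T in F) tverts T == [set: V]].

Definition forest_weight (F : {set rtree V}) : R :=
  \prod_(T in F) \prod_(e in tedges T) weight G e.

Definition forest_partition (F : {set rtree V}) : {set {set V}} :=
  [set tverts T | T in F].

Definition lep_Z (q : R) : R :=
  \sum_(F | spanning_rooted_forest F) q ^+ #|F| * forest_weight F.

Definition lep_law (q : R) (P : {set {set V}}) : R :=
  (lep_Z q)^-1 *
  \sum_(F | spanning_rooted_forest F && (forest_partition F == P))
     q ^+ #|F| * forest_weight F.

Definition lep_prob (q : R) (A : pred {set {set V}}) : R :=
  \sum_(P | partition P [set: V] && A P) lep_law q P.

(** [pblock P x] is the block B_q(x) when P is the value of the random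
    partition. *)
Definition lep_U (q : R) (x y : V) : R :=
  lep_prob q [pred P | pblock P x != pblock P y].

End LoopErasedPartition.

Section CompleteGraph.
Variables (R : realType) (N : nat) (w : R) (w_gt0 : 0 < w).

Definition complete_edges : {set {set 'I_N}} := [set e : {set 'I_N} | #|e| == 2%N].

Lemma complete_edges_simple (e : {set 'I_N}) : e \in complete_edges -> #|e| = 2%N.
Proof. by rewrite inE => /eqP. Qed.

Lemma complete_connected (x y : 'I_N) : connect (adj complete_edges) x y.
Proof.
have [->|xy] := eqVneq x y; first exact: connect0.
by apply: connect1; rewrite /adj /= inE cards2 xy.
Qed.

Definition complete_graph : wgraph R 'I_N :=
  @WGraph R 'I_N complete_edges (fun=> w) complete_edges_simple
    (fun _ _ => ltW w_gt0) complete_connected.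

End CompleteGraph.

Arguments complete_graph {R} N {w} w_gt0.

(* Main.v *)
(** A rooted spanning forest of the complete graph is the same thing as a map
    f sending each vertex to its parent and each root to itself, subject to
    the iterates of f being eventually constant at a root.  Write
    c = q + N w.  Deleting one vertex y from such a map, and treating the
    deleted vertices as absorbing, shows by induction on the set M of live
    vertices that the total weight of the maps leading a given y in M to a
    given absorbing vertex is w c^(|M|-1), that of the maps leading y to a
    root in M is q c^(|M|-1), and that the weight D_m of the maps on M, with
    |M| = m, that give x and y two different roots in M satisfies
    D_m = q^2 c^(m-2) + (m-2) w D_(m-1).  With Z = q c^(N-1) this is the
    finite formula.

    For the limit put r = sqrt N and n = N - 2.  Integration by parts in
    I_n = int_0^oo exp(-(z+r)t) (1+t/r)^n dt gives the same recursion, whence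
    U = z I_n.  The integrand is at most exp(-zt) and converges to
    exp(-zt-t^2/2), so dominated convergence and the shift s = t + z give the
    Gaussian tail. *)

Require Import Defs.
From HB Require Import structures.
From mathcomp Require Import all_boot all_order all_algebra ring lra.
From mathcomp Require Import boolp reals.

Set Implicit Arguments.
Unset Strict Implicit.
Unset Printing Implicit Defensive.

Import Order.TTheory GRing.Theory Num.Theory.

(** * Parent maps *)

Section ParentMaps.
Variable V : finType.
Implicit Types (f g : {ffun V -> V}) (v y u r : V) (M : {set V}).

Definition pm_acyclic f := [forall v, [exists r, fconnect f v r && (f r == r)]].
(* A vertex reaches its root in fewer than [#|V|] steps. *)
Definition pm_root f v := iter #|V| f v.
Definition upd f y u : {ffun V -> V} := [ffun v => if v == y then u else f v].

Lemma updE f y u v : upd f y u v = if v == y then u else f v.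
Proof. by rewrite ffunE. Qed.

Lemma upd_upd f y u u' : upd (upd f y u) y u' = upd f y u'.
Proof. by apply/ffunP=> v; rewrite !updE; case: eqP. Qed.

Lemma upd_id f y : upd f y (f y) = f.
Proof. by apply/ffunP=> v; rewrite updE; case: eqP => // ->. Qed.

Lemma pm_root_eq f v r : fconnect f v r -> f r = r -> pm_root f v = r.
Proof.
move=> vr fr; have nV : findex f v r <= #|V|.
  by apply: leq_trans (ltnW (findex_max vr)) (max_card _).
by rewrite /pm_root -(subnK nV) iterD iter_findex // iter_fix.
Qed.

Lemma fconnect_pm_root f v : fconnect f v (pm_root f v).
Proof. exact: fconnect_iter. Qed.

Lemma pm_root_fix f v : pm_acyclic f -> f (pm_root f v) = pm_root f v.
Proof. by move/forallP/(_ v)/existsP=> [r /andP[vr /eqP fr]]; rewrite (pm_root_eq vr). Qed.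

Lemma pm_acyclicP f : reflect (forall v, f (pm_root f v) = pm_root f v) (pm_acyclic f).
Proof.
apply: (iffP idP) => [fA v|fP]; first exact: pm_root_fix.
apply/forallP=> v; apply/existsP; exists (pm_root f v).
by rewrite fconnect_pm_root fP eqxx.
Qed.

Lemma pm_root_id f r : f r = r -> pm_root f r = r.
Proof. exact/pm_root_eq/connect0. Qed.

Lemma pm_root_idP f r : pm_acyclic f -> (pm_root f r == r) = (f r == r).
Proof.
move=> fA; apply/eqP/eqP => [rr|/pm_root_id//].
by rewrite -{1}rr pm_root_fix.
Qed.

Lemma pm_root_step f v : pm_acyclic f -> pm_root f (f v) = pm_root f v.
Proof. by move=> fA; rewrite /pm_root -iterSr iterS; apply: pm_root_fix. Qed.

Lemma pm_root_connect f u v : pm_acyclic f -> fconnect f u v -> pm_root f u = pm_root f v.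
Proof. by move=> fA /iter_findex <-; elim: findex => //= n ->; rewrite pm_root_step. Qed.

(** A periodic point returns to itself after [#|V| * n.+1] steps, but by then it has already reached
    its root and stayed there. *)
Lemma cycle_fix f v n : pm_acyclic f -> iter n.+1 f v = v -> f v = v.
Proof.
move=> fA vn; suff -> : v = pm_root f v by exact: pm_root_fix.
have vk k : iter (k * n.+1) f v = v.
  by elim: k => // k IH; rewrite mulSn iterD IH.
rewrite -{1}(vk #|V|) mulnS addnC iterD; apply: iter_fix.
exact: pm_root_fix.
Qed.

Lemma upd_connect f y u v r :
  f y = y -> fconnect f v r -> fconnect (upd f y u) v r.
Proof.
move=> fy /iter_findex <-; move: (findex _ _ _) => n; elim: n v => [|n IH] v; first exact: connect0.
have [->|vy] := eqVneq v y; first by rewrite iter_fix ?connect0.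
rewrite iterSr; apply: connect_trans (IH _).
by apply: connect1; rewrite /= updE (negbTE vy).
Qed.

(** Hanging the root y below u sends the whole tree of y to the root of u. The last hypothesis keeps
    this from closing a cycle. *)
Lemma pm_root_upd f y u v : pm_acyclic f -> f y = y -> u = y \/ pm_root f u <> y ->
  pm_root (upd f y u) v = if pm_root f v == y then pm_root f u else pm_root f v.
Proof.
move=> fA fy uy.
have cu : fconnect (upd f y u) y (pm_root f u).
  apply: connect_trans (upd_connect _ fy (fconnect_pm_root f u)).
  by apply: connect1; rewrite /= updE eqxx.
have fixr r : f r = r -> r <> y -> upd f y u r = r.
  by move=> fr /eqP/negbTE ry; rewrite updE ry.
have fixu : upd f y u (pm_root f u) = pm_root f u.
  case: uy => [->|uy]; first by rewrite updE pm_root_id // eqxx.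
  by apply: fixr => //; exact: pm_root_fix.
case: eqP => [vy|vy]; apply: pm_root_eq => //.
- apply: connect_trans cu; have := fconnect_pm_root f v.
  by rewrite vy => /(upd_connect u fy).
- exact: upd_connect fy (fconnect_pm_root f v).
- by apply: fixr => //; exact: pm_root_fix.
Qed.

(** Hanging the root y below another vertex u closes a cycle exactly when u already lies in the tree
    of y. *)
Lemma pm_acyclic_upd f y u : f y = y ->
  pm_acyclic (upd f y u) = pm_acyclic f && ((u == y) || (pm_root f u != y)).
Proof.
move=> fy; apply/idP/andP=> [gA|[fA uy]]; last first.
  have uy' : u = y \/ pm_root f u <> y by case/orP: uy => /eqP uy; [left | right].
  apply/pm_acyclicP=> v; rewrite pm_root_upd //.
  case: (eqVneq (pm_root f v) y) => vy.
    case: uy' => [->|/eqP/negbTE uy']; last by rewrite updE uy' pm_root_fix.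
    by rewrite updE pm_root_id // eqxx.
  by rewrite updE (negbTE vy) pm_root_fix.
(* Conversely, f is the updated map g cut at y: a path of g to a root either avoids y and is a path
   of f, or reaches y, which is a root of f. *)
have fE : f = upd (upd f y u) y y by rewrite upd_upd -{2}fy upd_id.
set g := upd f y u in gA fE.
have gf v r : fconnect g v r -> g r = r -> exists2 s, fconnect f v s & f s = s.
  move=> /iter_findex <-; move: (findex _ _ _) => n; elim: n v => [|n IH] v gr.
    exists v; rewrite ?connect0//; rewrite fE updE; case: eqP => // _.
  have [->|vy] := eqVneq v y; first by exists y.
  rewrite iterSr in gr; have [s gs fs] := IH _ gr; exists s => //.
  apply: connect_trans gs; apply: connect1.
  by rewrite /= fE updE (negbTE vy).
split.
  apply/forallP=> v; apply/existsP.
  have [s vs fs] := gf _ _ (fconnect_pm_root g v) (pm_root_fix v gA).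
  by exists s; rewrite vs fs eqxx.
have [//|uy /=] := eqVneq u y; apply/eqP=> fuy.
(* The path from u to y followed by the new arrow from y to u would be a cycle of g. *)
have guy : fconnect g u y.
  by have := fconnect_pm_root f u; rewrite fuy => /(upd_connect u fy).
have gy : g y = u by rewrite updE eqxx.
move/iter_findex: guy; move: (findex _ _ _) => n.
rewrite -{1}gy -iterSr => /(cycle_fix gA); rewrite gy => uy'.
by rewrite uy' eqxx in uy.
Qed.

(** * Weighted sums over acyclic maps, by deletion of a vertex *)

Variables (R : fieldType) (q w : R).
Local Open Scope ring_scope.
Definition pm_weight M f : R := \prod_(v in M) (if f v == v then q else w).

(* The vertices outside [M] are absorbing: they are encoded as fixed points
   too, but carry no weight. *)
Definition pm_on M f := pm_acyclic f && [forall v, (v \notin M) ==> (f v == v)].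

(** The bijection sends f to the pair of f cut at y and the value u = f y. By [pm_acyclic_upd], the
    admissible u are y itself and the vertices that the cut map does not lead to y. *)
Lemma sum_pm_on_upd M y (F : {ffun V -> V} -> R) : y \in M ->
  \sum_(f | pm_on M f) pm_weight M f * F f =
  \sum_(g | pm_on (M :\ y) g) pm_weight (M :\ y) g *
    \sum_(u | (u == y) || (pm_root g u != y)) (if u == y then q else w) * F (upd g y u).
Proof.
move=> yM.
under [RHS]eq_bigr do rewrite big_distrr /=.
rewrite pair_big_dep /=.
rewrite (reindex_onto (fun p : {ffun V -> V} * V => upd p.1 y p.2) (fun f => (upd f y y, f y))) /=; last first.
  by move=> f _; rewrite upd_upd upd_id.
apply: eq_big => [[g u]|[g u]] /=.
  rewrite upd_upd xpair_eqE !updE !eqxx andbT; apply/idP/idP.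
    case/andP=> /andP[fA /forallP fM] /eqP gE.
    have gy : g y = y by rewrite -gE updE eqxx.
    rewrite /pm_on; move: fA; rewrite pm_acyclic_upd // => /andP[-> ->]; rewrite andbT /=.
    apply/forallP=> v; apply/implyP; rewrite in_setD1.
    have [->|vy] /= := eqVneq v y; first by rewrite gy.
    by move: (fM v); rewrite updE (negbTE vy) => /implyP.
  case/andP=> /andP[gA /forallP gM] uy.
  have gy : g y = y by move: (gM y); rewrite setD11 => /eqP.
  have -> : upd g y y = g by rewrite -{2}gy upd_id.
  rewrite eqxx andbT /pm_on pm_acyclic_upd // gA uy /=.
  apply/forallP=> v; apply/implyP => vM; rewrite updE.
  have vy : v != y by apply: contraNneq vM => ->.
  by rewrite (negbTE vy); move: (gM v); rewrite in_setD1 (negbTE vM) andbF.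
move=> _; rewrite /pm_weight (big_setD1 y) //= updE eqxx -!mulrA mulrCA; congr (_ * _).
apply: eq_bigr => v /setD1P[/negbTE vy _]; by rewrite updE vy.
Qed.

Local Notation wsum M P := (\sum_(f | pm_on M f) pm_weight M f * (P f)%:R).

Lemma pm_on_id M f v : pm_on M f -> v \notin M -> f v = v.
Proof. by case/andP=> _ /forallP/(_ v)/implyP fM /fM /eqP. Qed.

Lemma pm_on_root M f v : pm_on M f -> v \notin M -> pm_root f v = v.
Proof. by move=> fM vM; apply/pm_root_id/(pm_on_id fM). Qed.

(** The first term is the case where y is a root, the second the case where y has a parent u. Events
    enter as 0-1 factors. *)
Lemma sum_pm_on_step M y (P : {ffun V -> V} -> bool) : y \in M ->
  wsum M P = q * wsum (M :\ y) P +
    w * \sum_(u | u != y) wsum (M :\ y) (fun g => (pm_root g u != y) && P (upd g y u)).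
Proof.
move=> yM; rewrite (sum_pm_on_upd _ yM) exchange_big /= !big_distrr -big_split /=.
apply: eq_bigr => g gM.
rewrite (bigD1 y) ?eqxx //= mulrDr; congr (_ + _).
  have -> : upd g y y = g by rewrite -{2}(pm_on_id gM (negbT (setD11 _ _))) upd_id.
  by rewrite mulrCA.
rewrite !mulr_sumr [LHS]big_mkcond [RHS]big_mkcond; apply: eq_bigr => u _ /=.
case: (eqVneq u y) => //= uy; case: eqP => //= _; rewrite ?mulr0 //.
by rewrite mulrCA.
Qed.

(** First-step analysis: unless y is a root, its root is that of its parent u, computed in the map
    where y is absorbing. *)
Lemma sum_pm_on_root M y (Q : pred V) : y \in M ->
  wsum M (fun f => Q (pm_root f y)) = q * (Q y)%:R * \sum_(g | pm_on (M :\ y) g) pm_weight (M :\ y) g +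
    w * \sum_(u | u != y) wsum (M :\ y) (fun g => (pm_root g u != y) && Q (pm_root g u)).
Proof.
move=> yM; rewrite (sum_pm_on_step _ yM) -mulrA; congr (q * _ + w * _).
  rewrite mulr_sumr; apply: eq_bigr => g gM.
  by rewrite (pm_on_root gM) ?setD11 // mulrC.
apply: eq_bigr => u _; apply: eq_bigr => g gM; congr (_ * (_ : bool)%:R).
have [//|/eqP uy /=] := eqVneq (pm_root g u) y.
have gy := pm_on_id gM (negbT (setD11 _ _)).
rewrite pm_root_upd //; last by right.
  by rewrite (pm_root_id gy) eqxx.
by case/andP: gM.
Qed.

Lemma sum_setD1C M y (F : V -> R) : y \in M ->
  \sum_(u | u != y) F u = \sum_(u in M :\ y) F u + \sum_(u | u \notin M) F u.
Proof.
move=> yM; rewrite (bigID (mem M)) /=; congr (_ + _); apply: eq_bigl => u.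
  by rewrite in_setD1.
by case: eqVneq => // ->; rewrite yM.
Qed.

Let c := q + #|V|%:R * w.

Lemma pm_on_set0 f : pm_on set0 f = (f == [ffun v => v]).
Proof.
apply/idP/eqP=> [fM|->]; first by apply/ffunP=> v; rewrite ffunE (pm_on_id fM) ?in_set0.
apply/andP; split; last by apply/forallP=> v; rewrite ffunE eqxx implybT.
by apply/pm_acyclicP=> v; rewrite ffunE.
Qed.

Lemma sum_pm_on0 : \sum_(f | pm_on set0 f) pm_weight set0 f = 1.
Proof.
by rewrite (eq_bigl _ _ pm_on_set0) big_pred1_eq /pm_weight big_set0.
Qed.

(** The determinant of the m by m matrix c I - w J, with J the all-ones matrix, as the matrix-tree
    theorem predicts for m live vertices. *)
Let Zm m : R := if m is m'.+1 then (q + (#|V| - m)%:R * w) * c ^+ m' else 1.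

(** This adds up the possible first steps towards an absorbing target: m live parents, or the target
    itself. At m = 0 the factor m cancels the term with the truncated exponent. *)
Lemma Zm_step m : (m < #|V|)%N -> m%:R * w * c ^+ m.-1 + Zm m = c ^+ m.
Proof.
case: m => [|m] mV /=; first by rewrite !mul0r add0r expr0.
rewrite exprS -mulrDl; congr (_ * _).
by rewrite addrCA -mulrDl -natrD subnKC // ltnW.
Qed.

(** The three claims are proved by a joint induction: the claims at m give the last two at m + 1 by
    deleting y, and these give the total weight at m + 1 by summing over the places where a fixed
    vertex can end. *)
Lemma pm_on_sums m :
  [/\ forall M, #|M| = m -> \sum_(f | pm_on M f) pm_weight M f = Zm m,
      forall M y t, #|M| = m -> y \in M -> t \notin M ->
        wsum M (fun f => pm_root f y == t) = w * c ^+ m.-1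
    & forall M y, #|M| = m -> y \in M ->
        wsum M (fun f => pm_root f y \in M) = q * c ^+ m.-1].
Proof.
elim: m => [|m [IZ IE IR]].
  split=> [M /cards0_eq ->|M y t /cards0_eq ->|M y /cards0_eq ->]; rewrite ?in_set0 //.
  exact: sum_pm_on0.
have cMy M y : #|M| = m.+1 -> y \in M -> #|M :\ y| = m.
  by move=> cM yM; apply/eqP; rewrite -eqSS -cM [in X in _ == X](cardsD1 y) yM.
have mV M : #|M| = m.+1 -> (m < #|V|)%N by move=> <-; apply: max_card.
(* A live parent of y leads on to t with the inductive weight, the parent t leaves the other live
   vertices free, and any other absorbing parent contributes 0. *)
have HE M y t : #|M| = m.+1 -> y \in M -> t \notin M ->
    wsum M (fun f => pm_root f y == t) = w * c ^+ m.
  move=> cM yM tM; have ty : t != y by apply: contraNneq tM => ->.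
  have yt := ty; rewrite eq_sym in yt.
  rewrite (sum_pm_on_root (fun v => v == t) yM) (negbTE yt) mulr0 mul0r add0r.
  rewrite -(Zm_step (mV _ cM)) (sum_setD1C _ yM); congr (w * (_ + _)).
    rewrite (eq_bigr (fun=> w * c ^+ m.-1)).
      by rewrite sumr_const (cMy M) // -mulrA mulr_natl.
    move=> u uM; rewrite -(IE (M :\ y) u t) ?(cMy M) //; last by rewrite in_setD1 (negbTE tM) andbF.
    apply: eq_bigr => g _; congr (_ * (_ : bool)%:R).
    by case: eqVneq => // ->; rewrite (negbTE yt).
  rewrite (bigD1 t) //= [X in _ + X]big1 => [|u /andP[uM ut]]; last first.
    apply: big1 => g gM; rewrite (pm_on_root gM) ?(negbTE ut) ?andbF ?mulr0 //.
    by rewrite in_setD1 (negbTE uM) andbF.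
  rewrite addr0 -(IZ _ (cMy _ _ cM yM)); apply: eq_bigr => g gM.
  by rewrite (pm_on_root gM) ?in_setD1 ?(negbTE tM) ?andbF // ty eqxx mulr1.
(* Either y is a root, with weight q times the total on the rest, or its parent is a live vertex
   whose root is live; absorbing parents contribute 0. *)
have HR M y : #|M| = m.+1 -> y \in M ->
    wsum M (fun f => pm_root f y \in M) = q * c ^+ m.
  move=> cM yM.
  rewrite (sum_pm_on_root (fun v => v \in M) yM) yM mulr1 (IZ _ (cMy _ _ cM yM)).
  rewrite (sum_setD1C _ yM) [X in _ + _ * (_ + X)]big1 => [|u uM]; last first.
    apply: big1 => g gM; rewrite (pm_on_root gM) ?(negbTE uM) ?andbF ?mulr0 //.
    by rewrite in_setD1 (negbTE uM) andbF.
  rewrite (eq_bigr (fun=> q * c ^+ m.-1)) => [|u uM].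
    rewrite sumr_const (cMy M) // addr0 -(Zm_step (mV _ cM)) mulrDr addrC -mulr_natl.
    by congr (_ + _); move: (c ^+ _) => cm; ring.
  rewrite -(IR (M :\ y) u) ?(cMy M) //.
  by apply: eq_bigr => g _; rewrite in_setD1.
split=> // M cM.
have /card_gt0P[y yM] : (0 < #|M|)%N by rewrite cM.
have := HR M y cM yM.
(* The chosen y ends either at a root in M or at exactly one absorbing vertex t; there are
   [#|V| - m.+1] such t. *)
transitivity (wsum M (fun f => pm_root f y \in M) +
   \sum_(t | t \notin M) wsum M (fun f => pm_root f y == t)).
  rewrite exchange_big -big_split /=; apply: eq_bigr => f fM.
  rewrite -mulr_sumr -mulrDr -[LHS]mulr1; congr (_ * _).
  case: (boolP (pm_root f y \in M)) => fy.
    rewrite big1 ?addr0 // => t tM; case: eqP => // e; by rewrite -e fy in tM.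
  rewrite (bigD1 (pm_root f y)) //= eqxx big1 ?addr0 ?add0r // => t /andP[_ tf].
  by rewrite eq_sym (negbTE tf).
rewrite HR // (eq_bigr (fun=> w * c ^+ m)) => [|t tM]; last exact: HE.
rewrite sumr_const -mulr_natl mulrA -mulrDl; congr ((_ + _%:R * _) * _).
by rewrite -cM -(cardsC M) addKn; apply: eq_card => t; rewrite !inE.
Qed.

(** With no absorbing vertex left, the factor in front of the power of c is q. For q = w = 1 this is
    Cayley's count (N+1)^(N-1) of rooted forests on N vertices. *)
Lemma sum_pm_onT : (0 < #|V|)%N ->
  \sum_(f | pm_acyclic f) pm_weight setT f = q * c ^+ #|V|.-1.
Proof.
have [+ _ _] := pm_on_sums #|V| => /(_ _ (cardsT V)) ZT V0.
transitivity (\sum_(f | pm_on setT f) pm_weight setT f).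
  apply: eq_bigl => f; rewrite /pm_on andb_idr // => _.
  by apply/forallP=> v; rewrite inE.
by rewrite ZT /Zm; case: #|V| V0 => //= n _; rewrite subnn mul0r addr0.
Qed.

Definition pm_separated M x y f := [&& pm_root f x \in M, pm_root f y \in M & pm_root f x != pm_root f y].

(** Delete x. If x is a root, y has to reach a root other than x. If x has a parent u, then u
    replaces x: u = y or u absorbing contributes 0, and a y leading to x would share the root of
    u. *)
Lemma sum_pm_separated_step m M x y : #|M| = m.+2 -> x \in M -> y \in M -> x != y ->
  wsum M (pm_separated M x y) = q * (q * c ^+ m) +
    w * \sum_(u in M :\ x :\ y) wsum (M :\ x) (pm_separated (M :\ x) u y).
Proof.
move=> cM xM yM xy.
have kM : #|M :\ x| = m.+1 by apply/eqP; rewrite -eqSS -cM [in X in _ == X](cardsD1 x) xM.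
have [_ _ ER] := pm_on_sums m.+1.
have ymx : y \in M :\ x by rewrite in_setD1 eq_sym xy.
rewrite (sum_pm_on_step _ xM) -(ER _ _ kM ymx) (sum_setD1C _ xM).
  rewrite [X in _ + _ * (_ + X)]big1 => [|u uM]; last first.
    apply: big1 => g gM; have gx := pm_on_id gM (negbT (setD11 _ _)).
    have ux : u != x by apply: contraNneq uM => ->.
    have gu : pm_root g u = u by rewrite (pm_on_root gM) // in_setD1 (negbTE uM) andbF.
    have gA : pm_acyclic g by case/andP: gM.
    rewrite /pm_separated pm_root_upd //; last by right; apply/eqP; rewrite gu.
    by rewrite (pm_root_id gx) eqxx gu (negbTE uM) andbF mulr0.
  rewrite (bigD1 y) //= addr0 [X in _ * (X + _)]big1 => [|g gM]; last first.
    have gx := pm_on_id gM (negbT (setD11 _ _)).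
    have gA : pm_acyclic g by case/andP: gM.
    case: eqVneq => [|/eqP yx]; rewrite ?mulr0 //=.
    rewrite /pm_separated !pm_root_upd //; try by right.
    by rewrite (pm_root_id gx) eqxx; case: ifP; rewrite eqxx /= ?andbF mulr0.
  rewrite add0r; congr (q * _ + w * _).
    apply: eq_bigr => g gM; congr (_ * (_ : bool)%:R).
    have gx := pm_on_id gM (negbT (setD11 _ _)).
    by rewrite /pm_separated (pm_root_id gx) xM /= in_setD1 eq_sym andbC.
  apply: eq_big => [u|u /andP[_ uy]]; first by rewrite [RHS]in_setD1 andbC.
  apply: eq_bigr => g gM; congr (_ * (_ : bool)%:R).
  have gx := pm_on_id gM (negbT (setD11 _ _)).
  have gA : pm_acyclic g by case/andP: gM.
  rewrite {2}/pm_separated !in_setD1; case: eqVneq => //= /eqP ux.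
  rewrite /pm_separated !pm_root_upd //; try by right.
  rewrite (pm_root_id gx) eqxx; case: eqVneq => //= _; by rewrite eqxx !andbF.
Qed.

(** The recursion is unrolled. Each deletion leaves one vertex fewer to choose u from, which
    produces the falling factorial. *)
Lemma sum_pm_separated m M x y : #|M| = m.+2 -> x \in M -> y \in M -> x != y ->
  wsum M (pm_separated M x y) = q ^+ 2 * \sum_(j < m.+1) (m ^_ j)%:R * w ^+ j * c ^+ (m - j).
Proof.
elim: m M x y => [|m IH] M x y cM xM yM xy; rewrite (sum_pm_separated_step cM xM yM xy).
  have kM : #|M :\ x :\ y| = 0%N.
    by move: cM; rewrite (cardsD1 x) xM (cardsD1 y) in_setD1 eq_sym xy yM => -[].
  rewrite (cards0_eq kM) big_set0 mulr0 addr0 big_ord_recl big_ord0 addr0.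
  by rewrite ffactn0 !expr0 !mulr1 expr2.
have kM : #|M :\ x| = m.+2 by apply/eqP; rewrite -eqSS -cM [in X in _ == X](cardsD1 x) xM.
have ymx : y \in M :\ x by rewrite in_setD1 eq_sym xy.
have lM : #|M :\ x :\ y| = m.+1 by apply/eqP; rewrite -eqSS -kM [in X in _ == X](cardsD1 y) ymx.
have IHu u (uM : u \in M :\ x :\ y) :=
  IH _ u y kM (proj2 (setD1P uM)) ymx (proj1 (setD1P uM)).
rewrite (eq_bigr _ IHu) sumr_const lM [in RHS]big_ord_recl ffactn0 expr0 subn0 !mul1r.
rewrite [RHS]mulrDr mulrA; congr (_ + _).
rewrite -mulr_natl !mulr_sumr.
apply: eq_bigr => j _; rewrite lift0 subSS ffactSS natrM [w ^+ _.+1]exprS.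
by move: (c ^+ _) (w ^+ _) => cm wm; ring.
Qed.
End ParentMaps.

(** * From forests to parent maps *)

Section ForestMap.
Variable V : finType.
Implicit Types (f g : {ffun V -> V}) (u v r : V) (E : {set {set V}}).

Lemma adj_sym E : symmetric (adj E).
Proof. by move=> x y; rewrite /adj /= setUC. Qed.

Lemma set2_eq (a b x y : V) : [set a; b] = [set x; y] ->
  (a = x /\ b = y) \/ (a = y /\ b = x).
Proof.
move=> e; have := set21 a b; have := set22 a b; rewrite e !inE.
have := set21 x y; have := set22 x y; rewrite -e !inE.
by move=> /orP[] /eqP + /orP[] /eqP + /orP[] /eqP + /orP[] /eqP; intuition congruence.
Qed.

#[local] Arguments adj : simpl never.

Definition avoid E v := [rel a b | [&& adj E a b, a != v & b != v]].

Lemma avoid_sym E v : symmetric (avoid E v).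
Proof. by move=> x y; rewrite /= adj_sym (andbC (x != v)). Qed.

(* When [E] is a tree, [par E r v u] says that u is the parent of v for the
   root r: u is the neighbour of v joined to r without passing through v. *)
Definition par E r v u := [&& adj E v u, u != v & connect (avoid E v) u r].

Lemma path_avoid E v a p : path (adj E) a p -> v \notin a :: p ->
  connect (avoid E v) a (last a p).
Proof.
elim: p a => [|b p IH] a; first by rewrite connect0.
move=> /= /andP[ab bp]; rewrite in_cons negb_or => /andP[va vp].
apply: connect_trans (IH _ bp vp); apply: connect1; rewrite /= ab eq_sym va /=.
by apply: contraNneq vp => ->; rewrite mem_head.
Qed.

Lemma connect_uniq_path (e : rel V) a b : connect e a b ->
  exists2 p, path e a p & uniq (a :: p) /\ last a p = b.
Proof.
case/connectP=> p ep ->; by case/shortenP: ep => p' ep' up' _; exists p'.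
Qed.

(** Two distinct parents are joined to each other through r by a simple path avoiding v; together
    with v it forms a cycle of length at least 3. *)
Lemma par_unique E r v u u' : acyclic E -> par E r v u -> par E r v u' -> u = u'.
Proof.
move=> /asboolP ac /and3P[vu uv ur] /and3P[vu' uv' ur']; apply/eqP/contraT=> uu'.
have uu : connect (avoid E v) u u'.
  by apply: connect_trans ur _; rewrite (sym_connect_sym (avoid_sym E v)).
have [p ep [up lp]] := connect_uniq_path uu.
have pE : path (adj E) u p by apply: sub_path ep => a b /and3P[].
have vp : v \notin u :: p.
  rewrite in_cons eq_sym negb_or uv /=.
  elim: p u {uu up lp pE vu uv ur uu'} ep => //= b p IH a /andP[/and3P[_ _ bv] bp].
  by rewrite in_cons eq_sym negb_or bv; apply: IH bp.
have := ac (v :: u :: p).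
case: p lp vp pE up {ep} => [/= uu''|a p lp vp pE up]; first by rewrite uu'' eqxx in uu'.
rewrite /ucycle /ucycleb cons_uniq vp up andbT.
have -> : cycle (adj E) [:: v, u, a & p].
  move: lp pE => /= lp /andP[ua ap].
  by rewrite vu ua rcons_path ap lp adj_sym vu'.
by move/(_ isT).
Qed.

(** Take a simple path from a to r. If it meets b, its part after b avoids a, so b is the parent of
    a; otherwise it avoids b, and a is the parent of b. *)
Lemma edge_par E r a b : acyclic E -> adj E a b -> a != b ->
  connect (adj E) a r -> par E r a b \/ par E r b a.
Proof.
move=> ac ab nab /connect_uniq_path[p ep [up lp]].
have [bp|bp] := boolP (b \in p); last first.
  right; rewrite /par adj_sym ab nab -lp; apply: path_avoid => //.
  by rewrite in_cons eq_sym negb_or nab.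
case/splitPr: bp ep up lp => p1 p2; rewrite cat_path /= => /and3P[_ _ ep2] /andP[ap _].
rewrite last_cat /= => lp; left; rewrite /par ab eq_sym nab -lp; apply: path_avoid => //.
by apply: contra ap; rewrite mem_cat => ->; rewrite orbT.
Qed.

Lemma path_par E r v u p : path (adj E) v (u :: p) -> uniq (v :: u :: p) ->
  last u p = r -> par E r v u.
Proof.
move=> /= /andP[vu up] /andP[vp _] lp; rewrite /par vu -lp path_avoid // eq_sym.
by move: vp; rewrite in_cons negb_or => /andP[-> _].
Qed.

Lemma par_connect E r f v : (forall v u, par E r v u -> f v = u) ->
  connect (adj E) v r -> fconnect f v r.
Proof.
move=> fp /connect_uniq_path[p ep [up lp]].
elim: p v ep up lp => [v _ _ <-|u p IH v ep up lp]; first exact: connect0.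
apply: connect_trans (IH u _ _ _) => //.
- by apply: connect1; rewrite /= (fp _ _ (path_par ep up lp)).
- by case/andP: ep.
- by case/andP: up.
Qed.

Lemma par_root E r u : par E r r u = false.
Proof.
apply/negP=> /and3P[_ ur /connectP[p]].
elim/last_ind: p => [_ /= ru|p x _]; first by rewrite ru eqxx in ur.
by rewrite rcons_path last_rcons => /andP[_ /and3P[_ _ xr]] rx; rewrite rx eqxx in xr.
Qed.

(** * The rooted forest of a parent map *)

Definition tree_of f r : rtree V :=
  ([set v | pm_root f v == r],
   [set [set v; f v] | v in [set v | (pm_root f v == r) && (f v != v)]], r).

Definition forest_of f : {set rtree V} := [set tree_of f r | r in [set r | f r == r]].

(** [order f v] counts the vertices on the way from v to its root, so it serves as a depth. *)
Lemma order_parent f v : pm_acyclic f -> f v != v -> order f (f v) < order f v.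
Proof.
move=> fA fv; apply/proper_card/properP; split.
  apply/fintype.subsetP=> u; rewrite !inE; apply: connect_trans.
  by apply: connect1 => /=.
exists v; rewrite !inE ?connect0 //.
by apply: contra fv => /iter_findex; rewrite -iterSr => /(cycle_fix fA) ->.
Qed.

Lemma tree_of_adj f r a b : adj (tedges (tree_of f r)) a b ->
  (f a = b \/ f b = a) /\ a != b.
Proof.
case/imsetP=> v; rewrite inE => /andP[_ fv] /set2_eq[] [-> ->].
  by split; [left | rewrite eq_sym].
by split; [right | ].
Qed.

(** On a cycle, take a vertex v of greatest depth. None of its neighbours there can be a child, so
    both are f v and coincide, which bounds the length by 2. *)
Lemma tree_of_acyclic f r : pm_acyclic f -> acyclic (tedges (tree_of f r)).
Proof.
move=> fA; apply/asboolP=> c /andP[cc uc].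
case: (pickP (mem c)) => [x0 xc|]; last by case: c {cc uc} => // x c /(_ x); rewrite /= mem_head.
have [v vc vmax] := arg_maxnP (order f) xc.
have [i s cs] := rot_to vc.
move: cc uc; rewrite -(rot_cycle i) -(rot_uniq i) -(size_rot i) cs.
case: s cs => [|u s] cs //= /andP[vu]; rewrite rcons_path => /andP[_ lv].
have step x : x \in c -> adj (tedges (tree_of f r)) v x -> f v = x.
  move=> xc' /tree_of_adj[[//|fx] vx].
  have /= := vmax x xc'; rewrite leqNgt -fx order_parent //.
  by rewrite fx.
have sc x : x \in u :: s -> x \in c.
  by move=> xs; rewrite -(mem_rot i) cs in_cons xs orbT.
have fu := step u (sc _ (mem_head _ _)) vu.
rewrite adj_sym in lv; have := step _ (sc _ (mem_last _ _)) lv; rewrite fu => ul.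
move/and3P=> [_ us _]; case: s us ul {cs lv step sc} => // y s us ul.
by move: us; rewrite {1}ul /= mem_last.
Qed.

Lemma tree_of_connect f r v : pm_acyclic f -> pm_root f v = r ->
  connect (adj (tedges (tree_of f r))) v r.
Proof.
move=> fA <-; rewrite {2}/pm_root; set r' := pm_root f v.
elim: #|V| => [|n IH] /=; first exact: connect0.
apply: connect_trans IH _; set u := iter n f v.
have [->|fu] := eqVneq (f u) u; first exact: connect0.
apply/connect1/imsetP; exists u => //; rewrite inE fu andbT.
by apply/eqP; rewrite -(pm_root_connect fA (fconnect_iter f n v)).
Qed.

Lemma tree_of_inj f : injective (tree_of f).
Proof. by move=> r r' []. Qed.

(** The edges carry no orientation, so f is recovered from the root outwards, by induction on the
    number of steps from v to its root. *)
Lemma forest_of_inj : {in pm_acyclic (V:=V) &, injective forest_of}.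
Proof.
have sub f f' r : forest_of f = forest_of f' -> f r = r ->
    f' r = r /\ tree_of f r = tree_of f' r.
  move=> ff fr; have /imsetP[r' +]: tree_of f r \in forest_of f'.
    by rewrite -ff imset_f // inE fr.
  by rewrite inE => /eqP fr' t; have /= rr := congr1 snd t; subst r'; split.
move=> f f' fA fA' ff; apply/ffunP=> v.
have [_ t] := sub _ _ _ ff (pm_root_fix v fA).
have [_ et] : tverts (tree_of f (pm_root f v)) = tverts (tree_of f' (pm_root f v)) /\
   tedges (tree_of f (pm_root f v)) = tedges (tree_of f' (pm_root f v)) by rewrite t.
have := iter_findex (fconnect_pm_root f v).
move: {t} (pm_root_fix v fA) et; move pr: (pm_root f v) => r fr et.
move: (findex _ _ _) => n; elim: n v pr => [|n IH] v pr.
  by move=> /= vr; move: fr; rewrite -vr => fv; have [-> _] := sub _ _ _ ff fv.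
rewrite iterSr => fnv.
have [fv|fv] := eqVneq (f v) v; first by have [-> _] := sub _ _ _ ff fv.
have : [set v; f v] \in tedges (tree_of f r) by apply/imsetP; exists v; rewrite ?inE ?pr ?eqxx.
(* The edge from v to f v may come in f' from v or from f v. In the second case the induction
   hypothesis at f v gives f (f v) = v, a cycle of length 2. *)
rewrite et => /tree_of_adj[[-> //|ffv] _].
have := IH (f v) _ fnv; rewrite pm_root_step // ffv => /(_ pr) ffv'.
by have := @cycle_fix _ f v 1 fA ffv' => e; rewrite e eqxx in fv.
Qed.

End ForestMap.

(** * The loop-erased partition of the complete graph through parent maps *)

Section CompleteForests.
Variables (R : realType) (N : nat) (w : R) (w_gt0 : (0 < w)%R).
Let G := complete_graph N w_gt0.
Implicit Types (f : {ffun 'I_N -> 'I_N}) (F : {set rtree 'I_N}).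

Lemma forest_of_spanning f : pm_acyclic f -> spanning_rooted_forest G (forest_of f).
Proof.
move=> fA; apply/and3P; split.
- apply/forall_inP=> _ /imsetP[r + ->]; rewrite inE => /eqP fr; apply/and4P; split.
  + by rewrite inE pm_root_id.
  + apply/fintype.subsetP=> _ /imsetP[v + ->]; rewrite !inE => /andP[/eqP pv fv].
    rewrite cards2 (eq_sym v) fv /=; apply/fintype.subsetP=> u.
    by rewrite !inE => /orP[] /eqP ->; rewrite ?pm_root_step // pv.
  + apply/forall_inP=> a; rewrite inE => /eqP pa; apply/forall_inP=> b; rewrite inE => /eqP pb.
    apply: connect_trans (tree_of_connect fA pa) _.
    by rewrite (sym_connect_sym (@adj_sym _ _)); apply: tree_of_connect.
  + exact: tree_of_acyclic.
- apply/forall_inP=> _ /imsetP[r rf ->]; apply/forall_inP=> _ /imsetP[r' rf' ->].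
  rewrite (inj_eq (@tree_of_inj _ f)); apply/implyP=> rr.
  apply/pred0P=> v /=; rewrite !inE; apply/negP=> /andP[/eqP e1 /eqP e]; move: rr.
  by rewrite -e1 e eqxx.
- apply/eqP/setP=> v; rewrite inE; apply/bigcupP; exists (tree_of f (pm_root f v)).
    by rewrite imset_f // inE pm_root_fix.
  by rewrite inE.
Qed.

Lemma spanning_forest_of F : spanning_rooted_forest G F ->
  exists2 f, pm_acyclic f & F = forest_of f.
Proof.
case/and3P=> /forall_inP Ft /forall_inP Fd /eqP Fc.
have Fv v : exists2 T, T \in F & v \in tverts T.
  by have : v \in [set: 'I_N] by []; rewrite -Fc => /bigcupP[T]; exists T.
have Fu T T' v : T \in F -> T' \in F -> v \in tverts T -> v \in tverts T' -> T = T'.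
  move=> TF TF' vT vT'; apply/eqP; apply: contraT => TT.
  have /forall_inP/(_ _ TF')/implyP/(_ TT) := Fd _ TF.
  by move/disjoint_setI0/setP/(_ v); rewrite !inE vT vT'.
have TE T a b : T \in F -> adj (tedges T) a b -> [/\ a \in tverts T, b \in tverts T & a != b].
  move=> /Ft/and4P[_ /fintype.subsetP + _ _] ab => /(_ _ ab); rewrite !inE => /andP[c2 /fintype.subsetP s].
  split; [apply: s; exact: set21 | apply: s; exact: set22 |].
  by move: c2; rewrite cards2; case: (a != b).
(* The parent is looked up in the tree containing v; disjointness of the trees and [par_unique] make
   it unique. The default value v is what makes roots fixed points. *)
pose f : {ffun 'I_N -> 'I_N} := [ffun v =>
  if [pick u | [exists T in F, par (tedges T) (troot T) v u]] is Some u then u else v].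
have Tac T : T \in F -> acyclic (tedges T) by move=> /Ft/and4P[].
have fp T v u : T \in F -> par (tedges T) (troot T) v u -> f v = u.
  move=> TF vu; rewrite ffunE; case: pickP => [u' /exists_inP[T' TF' vu']|/(_ u)/exists_inP[]]; last by exists T.
  have vT : v \in tverts T by case/and3P: vu => /(TE _ _ _ TF)[].
  have vT' : v \in tverts T' by case/and3P: vu' => /(TE _ _ _ TF')[].
  move: vu'; rewrite (Fu _ _ _ TF' TF vT' vT) => vu'.
  exact: par_unique (Tac _ TF) vu' vu.
have fP v : f v != v -> exists2 T, T \in F & par (tedges T) (troot T) v (f v).
  rewrite ffunE; case: pickP => [u /exists_inP[T TF vu] _|_]; last by rewrite eqxx.
  by exists T.
have rT T : T \in F -> troot T \in tverts T by case/Ft/and4P.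
have fr T : T \in F -> f (troot T) = troot T.
  move=> TF; apply/eqP; apply: contraT => /fP[T' TF' rp].
  have rT' : troot T \in tverts T' by case/and3P: rp => /(TE _ _ _ TF')[].
  by move: rp; rewrite (Fu _ _ _ TF' TF rT' (rT _ TF)) par_root.
have Tc T v : T \in F -> v \in tverts T -> connect (adj (tedges T)) v (troot T).
  by move=> TF vT; have /and4P[rT' _ /forall_inP/(_ _ vT)/forall_inP/(_ _ rT')] := Ft _ TF.
have fc T v : T \in F -> v \in tverts T -> pm_root f v = troot T.
  move=> TF vT; apply: pm_root_eq (fr _ TF).
  by apply: par_connect (Tc _ _ TF vT) => v' u; apply: fp.
have fA : pm_acyclic f.
  by apply/pm_acyclicP=> v; have [T TF vT] := Fv v; rewrite (fc _ _ TF vT) fr.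
have fT T : T \in F -> tree_of f (troot T) = T.
  move=> TF; have vE v : (v \in tverts T) = (pm_root f v == troot T).
    apply/idP/eqP=> [/(fc _ _ TF)//|].
    have [T' TF' vT'] := Fv v; rewrite (fc _ _ TF' vT') => tt.
    by rewrite -(Fu _ _ _ TF' TF (rT _ TF')) // tt rT.
  rewrite [RHS](_ : T = (tverts T, tedges T, troot T)); last by case: (T) => [[]].
  congr (_, _, _); first by apply/setP=> v; rewrite inE vE.
  apply/setP=> e; apply/imsetP/idP=> [[v]|eT].
    rewrite inE -vE => /andP[vT fv] ->; have [T' TF' vu] := fP _ fv.
    have vT' : v \in tverts T' by case/and3P: vu => /(TE _ _ _ TF')[].
    by move: vu; rewrite (Fu _ _ _ TF' TF vT' vT) => /and3P[].
  (* Every edge of T joins a vertex to its parent, by [edge_par], hence is an edge of the tree built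
     from f. *)
  have /cards2P[a [b [ab eab]]] : #|e| == 2.
    have /and4P[_ /fintype.subsetP/(_ _ eT) + _ _] := Ft _ TF.
    by rewrite !inE => /andP[].
  have eT' : adj (tedges T) a b by rewrite /adj /= -eab.
  have [aT bT _] := TE _ _ _ TF eT'.
  have [p|p] := edge_par (Tac _ TF) eT' ab (Tc _ _ TF aT).
    by exists a; rewrite ?inE -?vE ?aT (fp _ _ _ TF p) // eq_sym.
  by exists b; rewrite ?inE -?vE ?bT (fp _ _ _ TF p) // eab setUC.
exists f => //; apply/setP=> T; apply/idP/imsetP=> [TF|[r]].
  by exists (troot T); rewrite ?fT // inE fr.
rewrite inE => /eqP fr' ->; have [T' TF' rT'] := Fv r.
by have := fc _ _ TF' rT'; rewrite pm_root_id // => ->; rewrite fT.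
Qed.

Local Open Scope ring_scope.

(** Grouping the vertices by root, each root pays for one factor q, and every other vertex for the
    edge to its parent. *)
Lemma forest_of_weight (q : R) f : pm_acyclic f ->
  q ^+ #|forest_of f| * forest_weight G (forest_of f) = pm_weight q w setT f.
Proof.
move=> fA; rewrite -prodr_const /forest_weight -big_split /=.
rewrite big_imset /=; last by move=> ? ? _ _; apply: tree_of_inj.
rewrite /pm_weight [RHS](partition_big (pm_root f) (fun r => r \in [set r | f r == r])) /=; last first.
  by move=> v _; rewrite inE pm_root_fix.
apply: eq_bigr => r; rewrite inE => fr.
rewrite (bigD1 r) /= ?fr ?inE ?pm_root_id ?(eqP fr) ?eqxx //; congr (_ * _).
rewrite big_imset /=; last first.
  (* Different vertices give different edges: otherwise a and b would be each other's parent. *)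
  move=> a b; rewrite !inE => /andP[_ fa] /andP[_ fb] /set2_eq[[]//|[ab fab]].
  by have := @cycle_fix _ f b 1 fA; rewrite /= -ab fab => /(_ erefl) e; rewrite fab e eqxx in fa.
rewrite [RHS](eq_bigr (fun=> w)) => [|v /andP[/andP[_ /eqP pv] vr]].
  apply: eq_bigl => v; rewrite !inE; case: eqP => //= <-.
  by rewrite (eq_sym v) pm_root_idP.
by rewrite -(pm_root_idP v fA) pv eq_sym (negbTE vr).
Qed.

Lemma sum_forests (q : R) (P : pred {set rtree 'I_N}) :
  \sum_(F | spanning_rooted_forest G F && P F) q ^+ #|F| * forest_weight G F =
  \sum_(f | pm_acyclic f && P (forest_of f)) pm_weight q w setT f.
Proof.
transitivity (\sum_(F in [set forest_of f | f in [pred f | pm_acyclic f && P (forest_of f)]])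
    q ^+ #|F| * forest_weight G F).
  apply: eq_bigl => F; apply/andP/imsetP => [[FS FP]|[f /andP[fA fP] ->]].
    by have [f fA Ff] := spanning_forest_of FS; exists f; rewrite // inE fA -Ff.
  by rewrite forest_of_spanning.
rewrite big_imset /=; last by move=> f g /andP[fA _] /andP[gA _]; apply: forest_of_inj.
by apply: eq_bigr => f /andP[fA _]; rewrite forest_of_weight.
Qed.

Lemma forest_partition_of f : pm_acyclic f ->
  forest_partition (forest_of f) = preim_partition (pm_root f) setT.
Proof.
move=> fA; apply/setP=> B; apply/imsetP/imsetP=> [[T /imsetP[r]]|[v _ ->]].
  rewrite inE => /eqP fr -> ->; exists r => //; apply/setP=> u.
  by rewrite !inE /= (pm_root_id fr) eq_sym.
exists (tree_of f (pm_root f v)); first by rewrite imset_f // inE pm_root_fix.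
by apply/setP=> u; rewrite !inE eq_sym.
Qed.

Lemma pblock_forest_of f x y : pm_acyclic f ->
  (pblock (forest_partition (forest_of f)) x != pblock (forest_partition (forest_of f)) y)
   = (pm_root f x != pm_root f y).
Proof.
move=> fA; rewrite forest_partition_of //.
have /and3P[/eqP Pc Pt _] := preim_partitionP (pm_root f) [set: 'I_N].
rewrite eq_pblock ?Pc // pblock_equivalence_partition ?inE //.
by split=> // /eqP ->.
Qed.

Lemma lep_U_parent_maps (q : R) (x y : 'I_N) :
  lep_U G q x y = (\sum_(f : {ffun 'I_N -> 'I_N} | pm_acyclic f) pm_weight q w setT f)^-1 *
     \sum_(f : {ffun 'I_N -> 'I_N} | pm_acyclic f && (pm_root f x != pm_root f y)) pm_weight q w setT f.
Proof.
rewrite /lep_U /lep_prob /lep_law -mulr_sumr; congr (_^-1 * _).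
  rewrite /lep_Z (eq_bigl (fun F => spanning_rooted_forest G F && predT F)) => [|F].
    by rewrite sum_forests; apply: eq_bigl => f; rewrite andbT.
  by rewrite andbT.
transitivity (\sum_(F | spanning_rooted_forest G F &&
   (pblock (forest_partition F) x != pblock (forest_partition F) y))
     q ^+ #|F| * forest_weight G F).
  (* Each forest induces exactly one partition, so the sum of the law over partitions is a single
     sum over forests. *)
  rewrite [RHS](partition_big (@forest_partition _)
     (fun P => partition P [set: 'I_N] && (pblock P x != pblock P y))) /=.
    apply: eq_bigr => P /andP[_ xy]; apply: eq_bigl => F.
    by case: eqP => [->|_]; rewrite ?andbF // xy !andbT.
  move=> F /andP[/spanning_forest_of[f fA ->] ->].
  by rewrite andbT forest_partition_of // preim_partitionP.
rewrite (sum_forests q (fun F => pblock (forest_partition F) x != pblock (forest_partition F) y)).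
by apply: eq_bigl => f; case: (boolP (pm_acyclic f)) => //= fA; rewrite pblock_forest_of.
Qed.

(** This is the quotient of [sum_pm_separated] on all n + 2 vertices by the total weight q
    c^(n+1). *)
Lemma lep_U_complete (q : R) n (x y : 'I_N) : N = n.+2 -> 0 < q -> x != y ->
  lep_U G q x y = \sum_(j < n.+1) q / (q + N%:R * w) *
     ((n ^_ j)%:R * (w / (q + N%:R * w)) ^+ j).
Proof.
move=> Nn q0 xy; have cN : #|'I_N| = n.+2 by rewrite card_ord.
have c0 : 0 < q + N%:R * w by rewrite ltr_pwDl // mulr_ge0 // ltW.
rewrite lep_U_parent_maps sum_pm_onT ?cN // -cN card_ord (_ : N.-1 = n.+1); last by rewrite Nn.
set c := q + _ in c0 *.
have -> : \sum_(f : {ffun 'I_N -> 'I_N} | pm_acyclic f && (pm_root f x != pm_root f y)) pm_weight q w setT f =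
  \sum_(f | pm_on setT f) pm_weight q w setT f * (pm_separated setT x y f)%:R.
  rewrite big_mkcondr; apply: eq_big => f; last first.
    by rewrite /pm_separated !inE /=; case: ifP; rewrite ?mulr1 ?mulr0.
  by rewrite /pm_on andb_idr // => _; apply/forallP=> v; rewrite inE.
rewrite (@sum_pm_separated _ _ q w n) ?inE ?cardsT // card_ord !mulr_sumr; apply: eq_bigr => j _.
rewrite -/c expr_div_n exprS (_ : c ^+ n = c ^+ (n - j) * c ^+ j); last first.
  by rewrite -exprD subnK // leq_ord.
have := lt0r_neq0 c0; have := lt0r_neq0 q0 => q1 c1.
have c2 k : c ^+ k != 0 by rewrite expf_neq0.
move: (c2 j) (c2 (n - j)%N); move: (c ^+ j) (c ^+ (n - j)) => cj cn cj0 cn0.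
by field; rewrite ?q1 ?c1 ?cj0 ?cn0.
Qed.

End CompleteForests.

(** * The Gaussian limit *)

From mathcomp Require Import all_classical all_reals all_analysis.
From mathcomp Require Import measurable_realfun.
Import numFieldNormedType.Exports.
Local Open Scope classical_set_scope.
Local Open Scope ring_scope.

(** * Integrals of exp(-a t) (1 + b t)^n and bounds on the logarithm *)

Section ExpPoly.
Variable R : realType.
Notation mu := (@lebesgue_measure R).
Implicit Types (a b t z : R) (n : nat).

(** Used with a = z + sqrt N and b = 1 / sqrt N. The case b = 0, n = 0 is the pure exponential that
    dominates the others. *)
Definition epoly a b n t := expR (- a * t) * (1 + b * t) ^+ n.

Lemma is_derive_epoly a b n t : is_derive t 1 (epoly a b n)
  (n%:R * b * epoly a b n.-1 t - a * epoly a b n t).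
Proof.
have e : is_derive t 1 (fun t => expR (- a * t)) (- a * expR (- a * t)).
  have -> : (fun t : R => expR (- a * t)) = expR \o (fun t => - a * t) by [].
  by apply: is_derive_eq; rewrite /GRing.scale /= mulr1 mulrC.
have p : is_derive t 1 ((fun t => 1 + b * t) ^+ n) (n%:R * b * (1 + b * t) ^+ n.-1).
  by apply: is_derive_eq; rewrite /GRing.scale /=; case: n => [|n] /=; ring.
have -> : epoly a b n = (fun t => expR (- a * t)) * (fun t => 1 + b * t) ^+ n.
  by apply/funext => x; rewrite /epoly mulrfctE exprfctE.
by apply: is_derive_eq; rewrite /GRing.scale /= /epoly mulrfctE exprfctE; ring.
Qed.

Lemma continuous_epoly a b n : continuous (epoly a b n).
Proof.
move=> t; apply: differentiable_continuous; apply/derivable1_diffP.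
by have [] := is_derive_epoly a b n t.
Qed.

Lemma epoly_ge0 a b n t : 0 <= b -> 0 <= t -> 0 <= epoly a b n t.
Proof. by move=> b0 t0; rewrite mulr_ge0 ?expR_ge0 // exprn_ge0 // addr_ge0 // mulr_ge0. Qed.

(** Since 1 + b t <= exp(b t), the polynomial factor lowers the decay rate by at most n b. *)
Lemma epoly_le a b n t : 0 <= b -> 0 <= t ->
  epoly a b n t <= epoly (a - n%:R * b) 0 0 t.
Proof.
move=> b0 t0; rewrite /epoly mul0r addr0 expr0 mulr1.
rewrite [leRHS](_ : _ = expR (- a * t) * expR (b * t) ^+ n).
  rewrite ler_wpM2l ?expR_ge0 // lerXn2r ?nnegrE ?expR_ge0 ?expR_ge1Dx //.
  by rewrite addr_ge0 // mulr_ge0.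
by rewrite -expRM_natl -expRD; congr expR; ring.
Qed.

Lemma cvg_epoly0 a : 0 < a -> epoly a 0 0 t @[t --> +oo] --> 0.
Proof.
move=> a0; have -> : epoly a 0 0 = (fun x => expR (- (a * x))).
  by apply/funext => x; rewrite /epoly mul0r addr0 expr0 mulr1 mulNr.
apply: (@cvg_comp _ _ _ (fun x => a * x) (fun x => expR (- x)) (pinfty_nbhs R) (pinfty_nbhs R)).
  by apply: (gt0_cvgMry a0); exact: cvg_id.
exact: cvgr_expR.
Qed.

Lemma cvg_epoly a b n : 0 <= b -> n%:R * b < a -> epoly a b n t @[t --> +oo] --> 0.
Proof.
move=> b0 nb; apply: (@squeeze_cvgr _ _ _ _ (cst 0) (epoly (a - n%:R * b) 0 0)).
- near=> t; have t0 : 0 <= t by near: t; exact: nbhs_pinfty_ge.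
  by rewrite epoly_ge0 // epoly_le.
- exact: cvg_cst.
- by apply: cvg_epoly0; rewrite subr_gt0.
Unshelve. all: by end_near. Qed.

(** The integrand is the derivative of [- epoly a b n], which goes from -1 at 0 to 0 at infinity. It
    is nonnegative, since n b < a <= a (1 + b t), so the integral is computed before integrability
    is known. *)
Lemma ge0_integral_epoly a b n : 0 <= b -> n%:R * b < a ->
  (\int[mu]_(t in `[0%R, +oo[) (a * epoly a b n t - n%:R * b * epoly a b n.-1 t)%R%:E = 1)%E.
Proof.
move=> b0 nb.
have dE t : is_derive t 1 (- epoly a b n) (a * epoly a b n t - n%:R * b * epoly a b n.-1 t).
  have d := is_derive_epoly a b n t.
  by apply: is_derive_eq; rewrite opprB.
rewrite (@ge0_continuous_FTC2y _ _ (- epoly a b n) 0 0).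
- by rewrite fctE /epoly mulr0 expR0 mulr0 addr0 expr1n mulr1 EFinN oppeK add0e.
- move=> t t0; rewrite subr_ge0; case: n nb {dE} => [|n] nb /=.
    by rewrite !mul0r mulr_ge0 ?epoly_ge0 // ltW // (le_lt_trans _ nb) // mul0r.
  rewrite /epoly exprS mulrCA [leRHS]mulrCA ler_wpM2l ?expR_ge0 // mulrA.
  rewrite ler_wpM2r ?exprn_ge0 ?addr_ge0 ?mulr_ge0 //.
  rewrite (le_trans (ltW nb)) // ler_peMr ?lerDl ?mulr_ge0 //.
  by rewrite ltW // (le_lt_trans _ nb) // mulr_ge0.
- apply: continuous_subspaceT => t; apply: cvgB; apply: cvgM; try exact: cvg_cst; exact: continuous_epoly.
- by rewrite -oppr0; apply: cvgN; exact: cvg_epoly.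
- by move=> t _; have [] := dE t.
- by apply/cvg_at_right_filter; apply: cvgN; exact: continuous_epoly.
- by move=> t _; have [_ <-] := dE t; rewrite derive1E.
Qed.

Lemma integrable_epoly a b n : 0 <= b -> n%:R * b < a ->
  mu.-integrable `[(0:R), +oo[ (EFin \o epoly a b n).
Proof.
move=> b0 nb; have c0 : 0 < a - n%:R * b by rewrite subr_gt0.
have m a' b' n' : measurable_fun `[(0:R), +oo[ (epoly a' b' n').
  apply: measurable_funTS; apply: continuous_measurable_fun.
  exact: continuous_epoly.
(* For a pure exponential the previous lemma says that c times the integral is 1, which excludes an
   infinite value. The general case follows by domination. *)
have ie c : 0 < c -> mu.-integrable `[(0:R), +oo[ (EFin \o epoly c 0 0).
  move=> c1; apply/integrableP; split; first by apply/measurable_EFinP; exact: m.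
  have := @ge0_integral_epoly c 0 0 (lexx _); rewrite mul0r => /(_ c1).
  under eq_integral do rewrite !mul0r subr0 EFinM.
  rewrite ge0_integralZl //; first last.
  - by rewrite lee_fin ltW.
  - by move=> t /=; rewrite in_itv /= andbT => t0; rewrite lee_fin epoly_ge0.
  - by apply/measurable_EFinP; exact: m.
  move=> ci; under eq_integral.
    move=> t; rewrite inE /= in_itv /= andbT => t0.
    rewrite ger0_norm ?epoly_ge0 //; over.
  rewrite ltey; apply/eqP => ioo; move: ci; rewrite ioo.
  by rewrite gt0_muley ?lte_fin.
apply: le_integrable (ie _ c0) => //; first by apply/measurable_EFinP; exact: m.
move=> t /=; rewrite in_itv /= andbT => t0.
by rewrite lee_fin !ger0_norm ?epoly_ge0 // epoly_le.
Qed.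

Definition epolyI a b n : R := \int[mu]_(t in `[0%R, +oo[) epoly a b n t.

Lemma epolyI_rec a b n : 0 <= b -> n%:R * b < a ->
  epolyI a b n = a^-1 + n%:R * b / a * epolyI a b n.-1.
Proof.
move=> b0 nb.
have a0 : 0 < a by apply: le_lt_trans nb; rewrite mulr_ge0.
have nb' : n.-1%:R * b < a.
  by apply: le_lt_trans nb; rewrite ler_wpM2r // ler_nat leq_pred.
have i1 := integrable_epoly b0 nb; have i2 := integrable_epoly b0 nb'.
have : a * epolyI a b n - n%:R * b * epolyI a b n.-1 = 1.
  have iZ k m : mu.-integrable `[(0:R), +oo[ (EFin \o epoly a b m) ->
      mu.-integrable `[(0:R), +oo[ (EFin \o (fun t => k * epoly a b m t)).
    by move=> i; apply: eq_integrable (integrableZl _ k i) => // t _; rewrite /= EFinM.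
  rewrite /epolyI -!RintegralZl // -RintegralB //; [|exact: iZ|exact: iZ].
  by rewrite /Rintegral ge0_integral_epoly.
move=> /eqP; rewrite subr_eq => /eqP e.
by apply: (mulfI (lt0r_neq0 a0)); rewrite e; field; rewrite gt_eqF.
Qed.

Lemma epolyI_sum a b n : 0 <= b -> n%:R * b < a ->
  epolyI a b n = \sum_(j < n.+1) (n ^_ j)%:R * b ^+ j / a ^+ j.+1.
Proof.
move=> b0; elim: n => [|n IH] nb; rewrite epolyI_rec //.
  by rewrite big_ord1 !mul0r addr0 expr0 expr1 mulr1 mul1r.
have a0 : 0 < a by apply: le_lt_trans nb; rewrite mulr_ge0.
rewrite IH; last by apply: le_lt_trans nb; rewrite ler_wpM2r // ler_nat.
rewrite [RHS]big_ord_recl ffactn0 !expr0 expr1 !mul1r mulr_sumr; congr (_ + _).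
apply: eq_bigr => j _; rewrite lift0 ffactSS natrM [b ^+ _.+1]exprS [a ^+ _.+2]exprS /=.
by field; rewrite expf_neq0 gt_eqF.
Qed.

(** The two differences vanish at 0 and have derivatives x^2 / (1 + x) and x^3 / (1 + x). A cubic
    error is small enough because it is later multiplied by r^2 at x = t / r. *)
Lemma ln1Dx_bounds t : 0 <= t ->
  t - t ^+ 2 / 2 <= ln (1 + t) <= t - t ^+ 2 / 2 + t ^+ 3 / 3.
Proof.
move=> t0.
have l (x : R) : -1 < x -> is_derive x 1 (fun x => ln (1 + x)) (1 + x)^-1.
  move=> x1; have : is_derive (1 + x) 1 (@ln R) (1 + x)^-1.
    by apply: is_derive1_ln; rewrite -ltrBlDl sub0r.
  move=> l.
  have -> : (fun x : R => ln (1 + x)) = (@ln R) \o (fun x => 1 + x) by [].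
  by apply: is_derive_eq; rewrite /GRing.scale /=; ring.
have mono (F f : R -> R) : (forall x : R, -1 < x -> is_derive x 1 F (f x)) ->
    (forall x : R, 0 < x -> 0 <= f x) -> F 0 = 0 -> 0 <= F t.
  move=> dF f0 <-; apply: (@ger0_derive1_ndecry _ F 0) => //.
  - move=> x; rewrite in_itv /= andbT => x0.
    by have [] := dF x (lt_trans (ltrN10 _) x0).
  - move=> x; rewrite in_itv /= andbT => x0; rewrite derive1E.
    by have [_ ->] := dF x (lt_trans (ltrN10 _) x0); exact: f0.
  - apply: derivable_within_continuous => x; rewrite in_itv /= andbT => x0.
    by have [] := dF x (lt_le_trans (ltrN10 _) x0).
apply/andP; split; rewrite -subr_ge0.
  apply: (mono (fun x => ln (1 + x) - (x - x ^+ 2 / 2)) (fun x => x ^+ 2 / (1 + x))).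
  - move=> x x1; have lx := l x x1; apply: is_derive_eq; rewrite /GRing.scale /=.
    by field; rewrite gt_eqF // -ltrBlDl sub0r.
  - by move=> x x0; rewrite divr_ge0 ?sqr_ge0 // addr_ge0 // ltW.
  - by rewrite addr0 ln1; ring.
apply: (mono (fun x => x - x ^+ 2 / 2 + x ^+ 3 / 3 - ln (1 + x)) (fun x => x ^+ 3 / (1 + x))).
- move=> x x1; have lx := l x x1; apply: is_derive_eq; rewrite /GRing.scale /=.
  by field; rewrite gt_eqF // -ltrBlDl sub0r.
- by move=> x x0; rewrite divr_ge0 ?exprn_ge0 ?addr_ge0 // ltW.
- by rewrite addr0 ln1; ring.
Qed.

End ExpPoly.

(** * Dominated convergence and the Gaussian tail *)

Section Limit.
Variable R : realType.
Notation mu := (@lebesgue_measure R).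
Implicit Types (a b t z : R) (n : nat).

Let r n : R := Num.sqrt n.+2%:R.

Let r_gt0 n : 0 < r n. Proof. by rewrite sqrtr_gt0 ltr0n. Qed.

Let r_sqr n : r n ^+ 2 = n%:R + 2.
Proof. by rewrite sqr_sqrtr ?ler0n // -natrD addn2. Qed.

Lemma divr_sqrt_lt n z : 0 < z -> n%:R * (r n)^-1 < z + r n.
Proof.
move=> z0; rewrite ltr_pdivrMr // mulrDl -expr2 r_sqr.
by rewrite addrCA ltrDl addr_gt0 // mulr_gt0.
Qed.

Lemma cvg_sqrt_inv : (r n)^-1 @[n --> \oo] --> (0 : R).
Proof.
have -> : (fun n => (r n)^-1) = (fun n => Num.sqrt (@harmonic R n.+1)).
  by apply/funext => n; rewrite /r sqrtrV ?ler0n.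
rewrite -[X in _ --> X]sqrtr0.
apply: (@continuous_cvg _ _ _ _ _ (fun n => @harmonic R n.+1) (@Num.sqrt R)); first exact: sqrt_continuous.
by rewrite (cvg_shiftS (@harmonic R)); exact: cvg_harmonic.
Qed.

(** In the exponent -(z + r) t + n ln(1 + t / r), with n = r^2 - 2, the terms r t cancel and -z t -
    t^2 / 2 remains, up to O(1 / r). *)
Lemma cvg_epoly_gauss z t : 0 <= t ->
  epoly (z + r n) (r n)^-1 n t @[n --> \oo] --> expR (- (z * t) - t ^+ 2 / 2).
Proof.
move=> t0.
have e n : epoly (z + r n) (r n)^-1 n t =
    expR (- (z + r n) * t + n%:R * ln (1 + (r n)^-1 * t)).
  by rewrite /epoly expRD expRM_natl lnK // posrE ltr_pwDl // mulr_ge0 // invr_ge0 ltW.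
rewrite (eq_cvg _ _ e); apply: (@continuous_cvg _ _ _ _ _ _ (@expR R)).
  exact: continuous_expR.
apply: (@squeeze_cvgr _ _ _ _ (fun n => - (z * t) - t ^+ 2 / 2 - 2 * t * (r n)^-1)
    (fun n => - (z * t) - t ^+ 2 / 2 + t ^+ 3 / 3 * (r n)^-1)).
(* The logarithm l satisfies 0 <= l <= x, so the part -2 l of n l costs at most 2 t / r below; the
   Taylor remainder times r^2 is at most t^3 / (3 r) above. *)
- near=> n; set x := (r n)^-1 * t.
  have x0 : 0 <= x by rewrite mulr_ge0 // invr_ge0 ltW.
  have := ln1Dx_bounds x0; have := @le_ln1Dx _ x (lt_le_trans (ltrN10 _) x0).
  have : 0 <= ln (1 + x) by rewrite ln_ge0 // lerDl.
  move: (ln _) => l l0 lx /andP[l1 l2].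
  have nE : n%:R = r n ^+ 2 - 2 :> R by rewrite r_sqr addrK.
  have r0 : r n != 0 by rewrite gt_eqF.
  have r2 : 0 <= r n ^+ 2 by rewrite sqr_ge0.
  have u1 := ler_wpM2l r2 l1; have u2 := ler_wpM2l r2 l2.
  have e1 : r n ^+ 2 * (x - x ^+ 2 / 2) = r n * t - t ^+ 2 / 2 by rewrite /x; field.
  have e2 : r n ^+ 2 * (x - x ^+ 2 / 2 + x ^+ 3 / 3) = r n * t - t ^+ 2 / 2 + t ^+ 3 / 3 * (r n)^-1 by rewrite /x; field.
  have e3 : 2 * t * (r n)^-1 = 2 * x by rewrite /x; ring.
  rewrite nE e3; rewrite e1 in u1; rewrite e2 in u2.
  apply/andP; split; lra.
- rewrite -[X in _ --> X]subr0; apply: cvgB; first exact: cvg_cst.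
  rewrite -(mulr0 (2 * t)); apply: cvgM; [exact: cvg_cst | exact: cvg_sqrt_inv].
- rewrite -[X in _ --> X]addr0; apply: cvgD; first exact: cvg_cst.
  rewrite -(mulr0 (t ^+ 3 / 3)); apply: cvgM; [exact: cvg_cst | exact: cvg_sqrt_inv].
Unshelve. all: by end_near. Qed.

Lemma continuous_gauss_shift z : continuous (fun t => expR (- (z * t) - t ^+ 2 / 2)).
Proof.
move=> t; apply: (@continuous_comp _ _ _ (fun t => - (z * t) - t ^+ 2 / 2) (@expR R)); last exact: continuous_expR.
apply: cvgB; last by apply: cvgM; [exact: exprn_continuous | exact: cvg_cst].
by apply: cvgN; apply: cvgM; [exact: cvg_cst | exact: cvg_id].
Qed.

Lemma cvg_epolyI z : 0 < z ->
  epolyI (z + r n) (r n)^-1 n @[n --> \oo] -->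
    \int[mu]_(t in `[0%R, +oo[) expR (- (z * t) - t ^+ 2 / 2).
Proof.
move=> z0; rewrite /epolyI /Rintegral.
have ez : mu.-integrable `[(0:R), +oo[ (EFin \o epoly z 0 0).
  by apply: integrable_epoly; rewrite ?mul0r.
have mE (f : R -> R) : continuous f -> measurable_fun `[(0:R), +oo[ (EFin \o f).
  move=> cf; apply/measurable_EFinP; apply: measurable_funTS; exact: continuous_measurable_fun.
have cg := @continuous_gauss_shift z.
have f_f t : `[(0:R), +oo[%classic t ->
    (fun n => (EFin \o epoly (z + r n) (r n)^-1 n) t) @ \oo --> (EFin \o (fun t => expR (- (z * t) - t ^+ 2 / 2))) t.
  rewrite /= in_itv /= andbT => t0; apply: cvg_EFin; first exact: nearW.
  exact: cvg_epoly_gauss.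
(* By [epoly_le] the decay rate is at least z + r - n / r, and n / r <= r. *)
have f_g t n : `[(0:R), +oo[%classic t ->
   (`|(EFin \o epoly (z + r n) (r n)^-1 n) t| <= (EFin \o epoly z 0 0) t)%E.
  rewrite /= in_itv /= andbT => t0.
  have r0 : 0 <= (r n)^-1 by rewrite invr_ge0 ltW.
  rewrite lee_fin ger0_norm ?epoly_ge0 // (le_trans (epoly_le _ _ r0 t0)) //.
  rewrite /epoly !mul0r addr0 !expr0 !mulr1 ler_expR !mulNr lerN2 ler_wpM2r //.
  rewrite -addrA lerDl subr_ge0 ler_pdivrMr // -expr2 r_sqr lerDl //.
have [ig _ fg] := @dominated_convergence _ _ _ mu `[(0:R), +oo[ (measurable_itv _)
   (fun n => EFin \o epoly (z + r n) (r n)^-1 n)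
   (EFin \o (fun t => expR (- (z * t) - t ^+ 2 / 2))) (EFin \o epoly z 0 0)
   (fun n => mE _ (@continuous_epoly _ _ _ _)) (mE _ cg)
   (aeW mu f_f) ez (aeW mu f_g).
apply: fine_cvg; rewrite fineK //.
exact: integrable_fin_num.
Qed.

(** The shift by z turns the tail into an integral over the half-line, and (t + z)^2 / 2 = z^2 / 2 +
    z t + t^2 / 2 gives the constant. *)
Lemma integral_gauss_tail z :
  expR (z ^+ 2 / 2) * Num.sqrt (2 * pi) * fine (normal_prob (0:R) 1 `]z, +oo[) =
  \int[mu]_(t in `[0%R, +oo[) expR (- (z * t) - t ^+ 2 / 2).
Proof.
have n1 : 1 != 0 :> R by [].
have c := @continuous_normal_pdf R 0 1 n1.
rewrite /normal_prob integral_itv_obnd_cbnd; last first.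
  apply/measurable_EFinP; apply: measurable_funTS; exact: measurable_normal_pdf.
have dF (x : R) : is_derive x 1 (fun x => x + z) 1.
  by apply: is_derive_eq; rewrite addr0.
have F' : ((fun x : R => x + z)^`())%classic = cst 1.
  by apply/funext => x; rewrite derive1E; have [_ ->] := dF x.
have cF : continuous (fun x : R => x + z).
  by move=> x; apply: cvgD; [exact: cvg_id | exact: cvg_cst].
have := @increasing_ge0_integration_by_substitutiony R (fun x => x + z) (normal_pdf 0 1) 0.
rewrite add0r F' => -> //; last first.
- by move=> x _; exact: normal_pdf_ge0.
- exact: continuous_subspaceT.
- exact: cvg_addrr.
- by split; [move=> x _; have [] := dF x | apply/cvg_at_right_filter; exact: cF].
- exact: is_cvg_cst.
- exact: is_cvg_cst.
- by move=> x _; exact: cst_continuous.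
- by move=> x y _ _ xy; rewrite ltrD2r.
have s0 : 0 < Num.sqrt (2 * pi) :> R by rewrite sqrtr_gt0 mulr_gt0 // pi_gt0.
pose k := expR (z ^+ 2 / 2) * Num.sqrt (2 * pi).
have k0 : 0 < k by rewrite mulr_gt0 // expR_gt0.
have ki : 0 < k^-1 by rewrite invr_gt0.
have e (t : R) : normal_pdf 0 1 (t + z) = k^-1 * expR (- (z * t) - t ^+ 2 / 2).
  rewrite normal_pdfE // /normal_peak /normal_fun subr0 !expr1n mul1r -[pi *+ 2]mulr_natl.
  rewrite /k invfM mulrAC -expRN -expRD mulrC; congr (expR _ * _).
  by field.
transitivity (k * fine (\int[mu]_(t in `[0%R, +oo[) ((k^-1)%:E * (expR (- (z * t) - t ^+ 2 / 2))%:E))%E).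
  by congr (_ * fine _); apply: eq_integral => t _; rewrite -EFinM -e mulrfctE /= mulr1.
rewrite /Rintegral.
rewrite ge0_integralZl //; first last.
- by rewrite lee_fin ltW.
- apply/measurable_EFinP; apply: measurable_funTS; apply: continuous_measurable_fun.
  exact: continuous_gauss_shift.
(* [fine] sends both infinities to 0, so integrability is not needed. *)
case: (integral _ _ _) => [i| |].
- by rewrite /= mulVKf // gt_eqF.
- by rewrite gt0_muley ?lte_fin //= mulr0.
- by rewrite gt0_muleNy ?lte_fin //= mulr0.
Qed.

End Limit.

(** With N = n + 2, the factor at k = i + 2 is (n - i) / N. *)
Lemma prod_ffact (R : numFieldType) n j : (j <= n)%N ->
  \prod_(2 <= k < j.+2) (1 - k%:R / n.+2%:R) = (n ^_ j)%:R / n.+2%:R ^+ j :> R.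
Proof.
elim: j => [|j IH] jn; first by rewrite big_geq // ffactn0 expr0 divr1.
rewrite big_nat_recr //= IH ?(ltnW jn) // ffactnSr natrM exprSr.
have -> : (n - j)%:R = n.+2%:R - j.+2%:R :> R.
  by rewrite -[in RHS](subnK (ltnW jn)) -addnS -addnS natrD addrK.
have : n.+2%:R != 0 :> R by rewrite pnatr_eq0.
by move: n.+2%:R => m m0; field; rewrite m0 expf_neq0.
Qed.

Theorem theorem1 (R : realType) :
  (forall (q w : R) (q_gt0 : 0 < q) (w_gt0 : 0 < w) (N : nat) (N_ge1 : (1 <= N)%N)
     (x y : 'I_N), x != y ->
     lep_U (complete_graph N w_gt0) q x y =
       \sum_(1 <= h < N)
          q / (q + N%:R * w) * (N%:R * w / (q + N%:R * w)) ^+ (h - 1)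
          * \prod_(2 <= k < h.+1) (1 - k%:R / N%:R))
  /\
  (forall (z w : R) (z_gt0 : 0 < z) (w_gt0 : 0 < w)
     (x y : forall N : nat, 'I_(N.+2)), (forall N, x N != y N) ->
     forall (d : measure_display) (T : measurableType d) (P : probability T R)
       (Z : {RV P >-> R}),
     (forall A : set R, measurable A -> distribution P Z A = normal_prob 0 1 A) ->
     (fun N : nat =>
        lep_U (complete_graph N.+2 w_gt0) (z * w * Num.sqrt (N.+2)%:R) (x N) (y N))
       @ \oo -->
     Num.sqrt (2 * pi) * z * expR (z ^+ 2 / 2) * fine (P [set t | z < Z t])).
Proof.
split=> [q w q0 w0 [//|[|n]] _ x y xy | z w z0 w0 x y xy d T P Z dZ].
(* For N = 1 there are no two distinct vertices. *)
- by move: xy; rewrite (ord1 x) (ord1 y) eqxx.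
- rewrite (lep_U_complete w0 (erefl n.+2) q0 xy) big_add1 big_mkord.
  apply: eq_bigr => j _; rewrite prod_ffact ?leq_ord // subSS subn0 -[RHS]mulrA.
  congr (_ * _); rewrite !expr_div_n exprMn.
  have c0 : 0 < q + n.+2%:R * w by rewrite addr_gt0 // mulr_gt0 // ltr0n.
  have : n.+2%:R != 0 :> R by rewrite pnatr_eq0.
  move: n.+2%:R c0 => m c0 m0; move: (lt0r_neq0 c0) => c1.
  by field; rewrite ?m0 ?c1 !expf_neq0.
have zr n : (n%:R * (Num.sqrt n.+2%:R)^-1 < z + Num.sqrt n.+2%:R :> R).
  exact: divr_sqrt_lt.
have -> : P [set t | z < Z t] = normal_prob 0 1 `]z, +oo[.
  rewrite -dZ // /distribution /pushforward; congr (P _).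
  by apply/seteqP; split=> t /=; rewrite in_itv /= andbT.
have -> : Num.sqrt (2 * pi) * z * expR (z ^+ 2 / 2) * fine (normal_prob 0 1 `]z, +oo[) =
    z * \int[lebesgue_measure]_(t in `[0%R, +oo[) expR (- (z * t) - t ^+ 2 / 2) :> R.
  by rewrite -integral_gauss_tail; ring.
(* For q = z w r and N = r^2, c equals w r (z + r), so q / c = z / (z + r) and w / c = (1 / r) / (z
   + r). The finite formula is then z times the expansion [epolyI_sum]. *)
have UE n : lep_U (complete_graph n.+2 w0) (z * w * Num.sqrt n.+2%:R) (x n) (y n) =
    z * epolyI (z + Num.sqrt n.+2%:R) (Num.sqrt n.+2%:R)^-1 n.
  have r0 : 0 < Num.sqrt n.+2%:R :> R by rewrite sqrtr_gt0 ltr0n.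
  rewrite (lep_U_complete w0 (erefl n.+2) _ (xy n)) ?mulr_gt0 //.
  rewrite epolyI_sum ?invr_ge0 ?(ltW r0) // mulr_sumr; apply: eq_bigr => j _.
  have rr : n.+2%:R = Num.sqrt n.+2%:R ^+ 2 :> R by rewrite sqr_sqrtr ?ler0n.
  move: (Num.sqrt _) r0 rr => r r0 ->.
  have c0 : 0 < z + r by rewrite addr_gt0.
  rewrite (_ : z * w * r + r ^+ 2 * w = w * r * (z + r)); last by ring.
  rewrite (_ : w / (w * r * (z + r)) = r^-1 / (z + r)); last by field; rewrite !gt_eqF.
  rewrite expr_div_n exprS; have := expf_neq0 j (lt0r_neq0 c0); move: (r^-1 ^+ j) => rj cj.
  by field; rewrite cj !gt_eqF.
under eq_cvg do rewrite UE.
apply: cvgM; [exact: cvg_cst | exact: cvg_epolyI].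
Qed.
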